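(* Let $0<q<1$. For any integer $n>1$, we have $$(q^{\frac12};q)_\infty^{\varphi(n)}\geq\sup\left\{\prod_{d\mid n}(q^{\frac1d};q^{\frac1d})_\infty^{\mu(\frac nd)},\ (1-q^{\frac12})^{\varphi(n)}\prod_{d\mid n}(q;q^{\frac1d})_\infty^{\mu(\frac nd)},\ (1+q^{\frac12})^{\varphi(n)}\frac{\prod_{d\mid n}(q^{\frac1d};q^{\frac1d})_\infty^{\mu(\frac nd)}}{\prod_{d\mid n}(-q^{\frac1d};q^{\frac1d})_{d-1}^{\mu(\frac nd)}}\right\}.$$
   Context: For a base $r\in(0,1)$ and complex $a$, the shifted factorials are $(a;r)_0=1$, $(a;r)_m=\prod_{i=0}^{m-1}(1-ar^i)$, $(a;r)_\infty=\lim_{m\to\infty}(a;r)_m$; superscripts such as $(a;r)_\infty^{s}$ and $(a;r)_m^{s}$ denote powers $\big((a;r)_\infty\big)^s$ and $\big((a;r)_m\big)^s$. $\varphi$ is the Euler totient function, $\mu$ is the M\''obius function, and products over $d\mid n$ run over the positive divisors $d$ of $n$. *)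

(* Defs.v *)
(* MathComp / MathComp-Analysis. *)
From mathcomp Require Export all_boot all_order all_algebra.
From mathcomp Require Export all_classical all_reals all_analysis.

Set Implicit Arguments.
Unset Strict Implicit.
Unset Printing Implicit Defensive.

Import Order.TTheory GRing.Theory Num.Theory.
Import numFieldNormedType.Exports.

Local Open Scope classical_set_scope.
Local Open Scope ring_scope.

(* Stated over any [numFieldType], so that both real and complex arguments are
   covered. *)
Definition qpoch (K : numFieldType) (a r : K) (m : nat) : K :=
  \prod_(0 <= i < m) (1 - a * r ^+ i).

(* [lim] is total; over the real or complex numbers the limit exists whenever
   [`|r| < 1]. *)
Definition qpoch_inf (K : numFieldType) (a r : K) : K :=
  lim (qpoch a r m @[m --> \oo]).

(* Integer-valued, so that [x ^ moebius k] is the integer power of [ssrint].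
   For [k > 0], [size (primes k)] is the number of distinct prime divisors. *)
Definition moebius (k : nat) : int :=
  if (0 < k)%N && all (fun p => ~~ (p ^ 2 %| k)%N) (primes k)
  then (-1) ^+ size (primes k) else 0.

(* Main.v *)
Require Import Defs.
From mathcomp Require Import all_boot all_order all_algebra.
From mathcomp Require Import all_classical all_reals all_analysis.
From mathcomp Require Import ring lra.

(** Put [x = q^(1/n)], so that [q^(1/d) = x^(n/d)] for every divisor [d] of [n].
    The factors of [(q^(1/d); q^(1/d))_oo] are then the [1 - x^k] with [k] a
    positive multiple of [n/d].  Since the sum of the Moebius function over the
    common divisors of [k] and [n] is 1 or 0 according to whether [k] is coprime
    to [n] ([sum_moebius_coprime]), inclusion-exclusion
    ([prod_divisors_moebius]) turns the first Moebius product into the product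
    of [1 - x^k] over all [k] coprime to [n].  In the same way the second one is
    the product over the [k > n] coprime to [n], and the denominator of the
    third one is the product of [1 + x^k] over the [k < n] coprime to [n].

    Cut the integers into blocks [jn, (j+1)n).  Each block contains
    [totient n] integers coprime to [n], and they are symmetric about the
    midpoint [(j + 1/2) n], which corresponds to the factor [1 - q^(j + 1/2)] of
    [(q^(1/2); q)_oo].  For two symmetric factors, the arithmetic-geometric mean
    inequality gives [(1 - u)(1 - v) <= (1 - w)^2] where [w^2 = uv]; hence each
    block is at most [(1 - q^(j + 1/2))^(totient n)] ([block_le]).  The product
    of these bounds over all [j] is the first inequality.  In the second one the
    block [j = 0] is replaced by its own upper bound.  In the third one this
    block becomes a product of [(1 - u) / (1 + u)], which is bounded by the same
    symmetric pairing ([first_block_cayley_le]).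

    Everything is done on finite products of whole blocks, followed by a passage
    to the limit.  The negative exponents require the infinite products to be
    nonzero, which is [qpoch_inf_gt0]. *)

Import Order.TTheory GRing.Theory Num.Theory.
Import numFieldNormedType.Exports.

Local Open Scope classical_set_scope.
Local Open Scope ring_scope.

Set Implicit Arguments.
Unset Strict Implicit.
Unset Printing Implicit Defensive.

(** * Sums of the Moebius function *)

Lemma moebius_mulp (p d : nat) : prime p -> (0 < d)%N ->
  moebius (p * d) = if (p %| d)%N then 0 else - moebius d.
Proof.
move=> p_pr d_gt0; have p_gt0 := prime_gt0 p_pr.
rewrite /moebius muln_gt0 p_gt0 d_gt0 /=.
have [p_d|pNd] := boolP (p %| d)%N.
  case: allP => // /(_ p); rewrite mem_primes p_pr muln_gt0 p_gt0 d_gt0.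
  by rewrite dvdn_mulr // dvdn_pmul2l // p_d => /(_ isT).
have primesE : perm_eq (primes (p * d)) (p :: primes d).
  apply: uniq_perm; first exact: primes_uniq.
    by rewrite /= primes_uniq mem_primes p_pr d_gt0 (negbTE pNd).
  by move=> r; rewrite primesM // primes_prime // !inE.
rewrite (perm_all _ primesE) (perm_size primesE) /= -mulnn dvdn_pmul2l // pNd /=.
have -> : all (fun r => ~~ (r ^ 2 %| p * d)%N) (primes d) =
          all (fun r => ~~ (r ^ 2 %| d)%N) (primes d).
  apply: eq_in_all => r; rewrite mem_primes => /and3P[r_pr _ r_d].
  rewrite Gauss_dvdr // coprimeXl // prime_coprime // dvdn_prime2 //.
  by apply: contraNneq pNd => <-.
by case: ifP => _; rewrite ?oppr0 // exprS mulN1r.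
Qed.

(** For a prime [p] dividing [m], the divisors [p * d] and [d] with [d] prime to
    [p] cancel in pairs, and the remaining divisors are multiples of [p ^ 2],
    where the Moebius function vanishes. *)
Lemma sum_moebius (m : nat) : (0 < m)%N ->
  \sum_(d <- divisors m) moebius d = (m == 1)%N%:R.
Proof.
move=> m_gt0; have [m_le1|m_gt1] := leqP m 1.
  by have -> : m = 1%N; [apply/eqP; rewrite eqn_leq m_le1|rewrite big_seq1].
rewrite [in RHS]eqn_leq leqNgt m_gt1 /=.
set p := pdiv m; have p_pr : prime p by exact: pdiv_prime.
have p_gt0 := prime_gt0 p_pr; have p_m : (p %| m)%N by exact: pdiv_dvd.
have mE : (p * (m %/ p) = m)%N by rewrite mulnC divnK.
have mp_gt0 : (0 < m %/ p)%N by rewrite divn_gt0 // dvdn_leq.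
rewrite (bigID (fun d => (p %| d)%N)) /= -big_filter -[X in _ + X]big_filter.
have multE : perm_eq [seq d <- divisors m | (p %| d)%N]
    [seq (p * d)%N | d <- divisors (m %/ p)].
  apply: uniq_perm; first by rewrite filter_uniq ?divisors_uniq.
    rewrite map_inj_uniq ?divisors_uniq // => x y /eqP.
    by rewrite eqn_pmul2l // => /eqP.
  move=> d; rewrite mem_filter -dvdn_divisors //; apply/andP/mapP.
    case=> /dvdnP[e ->] dm; exists e; last by rewrite mulnC.
    by rewrite -dvdn_divisors // -(dvdn_pmul2l p_gt0) mE mulnC.
  case=> e; rewrite -dvdn_divisors // => e_mp ->.
  by rewrite dvdn_mulr // -mE dvdn_pmul2l.
have nmultE : perm_eq [seq d <- divisors m | ~~ (p %| d)%N]
    [seq d <- divisors (m %/ p) | ~~ (p %| d)%N].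
  apply: uniq_perm; rewrite ?filter_uniq ?divisors_uniq // => d.
  rewrite !mem_filter -!dvdn_divisors //; apply: andb_id2l => pNd.
  by rewrite -{1}mE Gauss_dvdr // coprime_sym prime_coprime.
rewrite (perm_big _ multE) (perm_big _ nmultE) /= big_map big_filter.
rewrite [X in _ + X]big_mkcond -big_split /= big_seq big1 // => d.
rewrite -dvdn_divisors // => /(dvdn_gt0 mp_gt0) d_gt0.
by rewrite moebius_mulp //; case: ifP => _; rewrite ?addr0 ?addNr.
Qed.

Lemma sum_moebius_coprime (n k : nat) : (0 < n)%N ->
  \sum_(d <- divisors n | (d %| k)%N) moebius d = (coprime k n)%:R.
Proof.
move=> n_gt0; rewrite /coprime -sum_moebius ?gcdn_gt0 ?n_gt0 ?orbT //.
rewrite -big_filter; apply: perm_big; apply: uniq_perm.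
- by rewrite filter_uniq ?divisors_uniq.
- exact: divisors_uniq.
by move=> d; rewrite mem_filter -!dvdn_divisors ?gcdn_gt0 ?n_gt0 ?orbT ?dvdn_gcd.
Qed.

(** * Moebius products as products over coprime integers *)

Lemma perm_divisors_codiv (n : nat) : (0 < n)%N ->
  perm_eq [seq (n %/ d)%N | d <- divisors n] (divisors n).
Proof.
move=> n_gt0; have codivK d : (d %| n)%N -> (n %/ (n %/ d))%N = d.
  move=> d_n; have nd_gt0 : (0 < n %/ d)%N.
    by apply: (dvdn_gt0 n_gt0); apply: dvdn_div.
  by rewrite -{1}(divnK d_n) mulKn.
apply: uniq_perm; rewrite ?divisors_uniq //.
  rewrite map_inj_in_uniq ?divisors_uniq // => d e.
  by rewrite -!dvdn_divisors // => /codivK {2}<- /codivK {2}<- ->.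
move=> d; rewrite -dvdn_divisors //; apply/mapP/idP => [[e]|d_n].
  by rewrite -dvdn_divisors // => e_n ->; rewrite dvdn_div.
by exists (n %/ d)%N; rewrite ?codivK // -dvdn_divisors ?dvdn_div.
Qed.

Lemma big_nat_multiples (K : pzSemiRingType) (M e : nat) (F : nat -> K) :
  (0 < e)%N ->
  \prod_(0 <= m < M) F (m * e)%N = \prod_(0 <= k < M * e | (e %| k)%N) F k.
Proof.
move=> e_gt0; rewrite [RHS]big_mkcond big_nat_mul; apply: eq_bigr => m _.
rewrite big_ltn ?ltn_pmul2r // dvdn_mull // big_nat_cond big1 ?Monoid.mulm1 // => k.
rewrite andbT => /andP[lo hi]; case: ifP => // /dvdnP[j kE]; move: lo hi.
by rewrite kE !ltn_pmul2r // ltnS => lo; rewrite leqNgt lo.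
Qed.

(** Exchanging the two products, [F k] receives the exponent
    [\sum_(e %| n, e %| k) moebius e], which is the indicator of
    [coprime k n].  The inner products stop at a multiple of [d] so that all of
    them cover the same range [k < B * n]. *)
Lemma prod_divisors_moebius (K : fieldType) (n B : nat) (F : nat -> K) :
  (0 < n)%N -> (forall k, F k != 0) ->
  \prod_(d <- divisors n)
     (\prod_(0 <= m < B * d) F (m * (n %/ d))%N) ^ moebius (n %/ d) =
  \prod_(0 <= k < B * n | coprime k n) F k.
Proof.
move=> n_gt0 F_neq0.
have expzM z : {morph (fun x : K => x ^ z) : x y / x * y}.
  by move=> x y; rewrite expfzMl.
transitivity (\prod_(d <- divisors n) \prod_(0 <= k < B * n)
    (if ((n %/ d) %| k)%N then F k ^ moebius (n %/ d) else 1)).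
  rewrite big_seq [RHS]big_seq; apply: eq_bigr => d.
  rewrite -dvdn_divisors // => d_n.
  have nd_gt0 : (0 < n %/ d)%N by apply: (dvdn_gt0 n_gt0); apply: dvdn_div.
  rewrite big_nat_multiples // -mulnA [(d * _)%N]mulnC divnK //.
  by rewrite (big_morph _ (expzM _) (exp1rz _ _)) big_mkcond.
rewrite exchange_big [RHS]big_mkcond; apply: eq_bigr => k _.
have expD : {morph (fun z : int => F k ^ z) : x y / x + y >-> x * y}.
  by move=> x y; rewrite expfzDr.
rewrite -(big_map (fun d => n %/ d)%N xpredT
  (fun e => if (e %| k)%N then F k ^ moebius e else 1)).
rewrite (perm_big _ (perm_divisors_codiv n_gt0)) -big_mkcond.
rewrite -(big_morph _ expD (expr0z _)) sum_moebius_coprime //.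
by case: coprime.
Qed.

Lemma prod_coprime_blocks (K : pzSemiRingType) (B n : nat) (F : nat -> K) :
  \prod_(0 <= k < B * n | coprime k n) F k =
  \prod_(0 <= j < B) \prod_(0 <= i < n | coprime i n) F (j * n + i)%N.
Proof.
rewrite big_mkcond big_nat_mul; apply: eq_bigr => j _.
rewrite [RHS]big_mkcond -{1}[(j * n)%N]add0n big_addn mulSn addnK.
by apply: eq_bigr => i _; rewrite addnC -!(coprime_sym n) /coprime gcdnMDl.
Qed.

(** * Symmetry of the coprime residues *)

Lemma prodr_coprime_const (R : pzSemiRingType) (n : nat) (c : R) :
  \prod_(0 <= k < n | coprime k n) c = c ^+ totient n.
Proof.
rewrite totient_count_coprime -prodrXr [LHS]big_mkcond.
by apply: eq_bigr => k _; rewrite coprime_sym; case: coprime.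
Qed.

Lemma coprime_subn (k n : nat) : (k <= n)%N -> coprime (n - k) n = coprime k n.
Proof.
move=> k_n; have nE : (n - k + k = n)%N by rewrite subnK.
by rewrite /coprime -{2}nE gcdnDl gcdnC -{2}nE gcdnDr.
Qed.

(** The square of the product is the product of the [f k * f (n - k)], because
    [k |-> n - k] permutes the [k < n] coprime to [n]. *)
Lemma prod_coprime_reflect_le (R : realDomainType) (n : nat) (f : nat -> R)
    (c : R) : (1 < n)%N -> 0 <= c ->
  (forall k, (0 < k < n)%N -> 0 <= f k) ->
  (forall k, (0 < k < n)%N -> f k * f (n - k)%N <= c ^+ 2) ->
  \prod_(0 <= k < n | coprime k n) f k <= c ^+ totient n.
Proof.
move=> n_gt1 c_ge0 f_ge0 f_le.
have drop0 (g : nat -> R) : \prod_(0 <= k < n | coprime k n) g k =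
    \prod_(1 <= k < n | coprime k n) g k.
  by rewrite big_ltn_cond ?(ltnW n_gt1) // /coprime gcd0n gtn_eqF.
rewrite -ler_sqr ?nnegrE ?exprn_ge0 //; last first.
  rewrite drop0 big_nat_cond; apply: prodr_ge0 => k /andP[/f_ge0 //].
rewrite drop0 expr2 {2}big_nat_rev /= add1n.
rewrite [X in _ * X](_ : _ = \prod_(1 <= k < n | coprime k n) f (n - k)%N); last first.
  rewrite big_nat_cond [RHS]big_nat_cond; apply: eq_big => [k|k _]; last by rewrite subSS.
  apply: andb_id2l => /andP[_ /ltnW k_n].
  by rewrite subSS coprime_subn.
rewrite -big_split -exprM mulnC exprM -prodr_coprime_const drop0.
rewrite big_nat_cond [leRHS]big_nat_cond; apply: ler_prod => k /andP[kn _].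
rewrite f_le // mulr_ge0 ?f_ge0 //.
by case/andP: kn => k0 kn; rewrite subn_gt0 kn ltn_subrL k0 (ltnW n_gt1).
Qed.

Lemma amgm_sqrt (R : realDomainType) (u v w : R) : 0 <= u -> 0 <= v ->
  w ^+ 2 = u * v -> w *+ 2 <= u + v.
Proof.
move=> u_ge0 v_ge0 wE; have [w_le0|w_gt0] := leP w 0.
  by rewrite (le_trans (mulrn_wle0 _ w_le0)) // addr_ge0.
rewrite -ler_sqr ?nnegrE ?addr_ge0 ?mulrn_wge0 ?(ltW w_gt0) //.
rewrite exprMn_n wE -subr_ge0.
by rewrite (_ : _ - _ = (u - v) ^+ 2) ?sqr_ge0 //; ring.
Qed.

(** Equivalent to [amgm_sqrt], since [(1 - u) * (1 - v) = 1 - (u + v) + w ^+ 2]. *)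
Lemma onem_mul_le (R : realDomainType) (u v w : R) : 0 <= u -> 0 <= v ->
  w ^+ 2 = u * v -> (1 - u) * (1 - v) <= (1 - w) ^+ 2.
Proof. by move=> u_ge0 v_ge0 wE; have := amgm_sqrt u_ge0 v_ge0 wE; nra. Qed.

(** The left-hand side is [(P - s) / (P + s)] with [P = 1 + w ^+ 2] and
    [s = u + v]; it decreases in [s], and [s = w *+ 2] gives the right-hand
    side. *)
Lemma cayley_mul_le (R : realFieldType) (u v w : R) :
  0 <= u -> 0 <= v -> 0 <= w -> w ^+ 2 = u * v ->
  (1 - u) / (1 + u) * ((1 - v) / (1 + v)) <= ((1 - w) / (1 + w)) ^+ 2.
Proof.
move=> u_ge0 v_ge0 w_ge0 wE; have uvw := amgm_sqrt u_ge0 v_ge0 wE.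
rewrite mulf_div expr_div_n ler_pdivrMr ?mulr_gt0 ?ltr_wpDr //.
rewrite mulrAC ler_pdivlMr ?exprn_gt0 ?ltr_wpDr // -subr_ge0.
have -> : (1 - u) * (1 - v) = 1 + w ^+ 2 - (u + v) by rewrite wE; ring.
have -> : (1 + u) * (1 + v) = 1 + w ^+ 2 + (u + v) by rewrite wE; ring.
rewrite (_ : _ - _ = (u + v - w *+ 2) * (1 + w ^+ 2) *+ 2); last by ring.
by rewrite mulrn_wge0 // mulr_ge0 ?subr_ge0 // addr_ge0 ?sqr_ge0.
Qed.

(** The exponents [j * n + k] and [j * n + (n - k)] add up to [(2 * j + 1) * n],
    so the corresponding powers of [x] have geometric mean [h * (x ^+ n) ^+ j]. *)
Lemma block_le (R : realDomainType) (x h : R) (n j : nat) :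
  0 <= x <= 1 -> 0 <= h <= 1 -> h ^+ 2 = x ^+ n -> (1 < n)%N ->
  \prod_(0 <= i < n | coprime i n) (1 - x ^+ (j * n + i)) <=
  (1 - h * (x ^+ n) ^+ j) ^+ totient n.
Proof.
move=> /andP[x_ge0 x_le1] /andP[h_ge0 h_le1] hE n_gt1.
apply: prod_coprime_reflect_le => // [|k _|k /andP[_ /ltnW k_n]].
- by rewrite subr_ge0 mulr_ile1 ?exprn_ge0 ?exprn_ile1 ?exprn_ge0.
- by rewrite subr_ge0 exprn_ile1.
apply: onem_mul_le; rewrite ?exprn_ge0 // exprMn hE -exprD -!exprM -exprD.
by congr (_ ^+ _); rewrite addnACA subnKC // addnn -muln2 addnC (mulnC n).
Qed.

Lemma first_block_cayley_le (R : realFieldType) (x h : R) (n : nat) :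
  0 <= x <= 1 -> 0 <= h <= 1 -> h ^+ 2 = x ^+ n -> (1 < n)%N ->
  \prod_(0 <= i < n | coprime i n) ((1 - x ^+ i) / (1 + x ^+ i)) <=
  ((1 - h) / (1 + h)) ^+ totient n.
Proof.
move=> /andP[x_ge0 x_le1] /andP[h_ge0 h_le1] hE n_gt1.
apply: prod_coprime_reflect_le => // [|k _|k /andP[_ /ltnW k_n]].
- by rewrite divr_ge0 ?subr_ge0 ?addr_ge0.
- by rewrite divr_ge0 ?subr_ge0 ?addr_ge0 ?exprn_ile1 ?exprn_ge0.
by apply: cayley_mul_le; rewrite ?exprn_ge0 // hE -exprD subnKC.
Qed.

(** * Convergence and positivity of infinite shifted factorials *)

Lemma qpoch_nonincreasing (R : realType) (a r : R) : 0 <= a < 1 -> 0 < r < 1 ->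
  {homo qpoch a r : m p / (m <= p)%N >-> p <= m}.
Proof.
move=> /andP[a_ge0 a_lt1] /andP[r_gt0 r_lt1].
have ari i : 0 <= a * r ^+ i <= 1.
  rewrite mulr_ge0 ?exprn_ge0 ?(ltW r_gt0) //=.
  by rewrite mulr_ile1 ?exprn_ile1 ?exprn_ge0 ?(ltW r_gt0) ?(ltW a_lt1) ?(ltW r_lt1).
apply/nonincreasing_seqP => m; rewrite /qpoch big_nat_recr //= ler_piMr //.
  by apply: prodr_ge0 => i _; rewrite subr_ge0; case/andP: (ari i).
by rewrite lerBlDr lerDl; case/andP: (ari m).
Qed.

(** From [1 - t = (1 + t / (1 - t))^-1 >= expR (- t / (1 - t))] and
    [t / (1 - t) <= t / (1 - a)] for each factor [t = a * r ^+ i <= a]; these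
    bounds add up to a geometric series.  The bound does not depend on [m], so
    it passes to the limit. *)
Lemma qpoch_ge_expR (R : realType) (a r : R) (m : nat) : 0 <= a < 1 -> 0 < r < 1 ->
  expR (- (a / (1 - r) / (1 - a))) <= qpoch a r m.
Proof.
move=> /andP[a_ge0 a_lt1] /andP[r_gt0 r_lt1].
apply: (@le_trans _ _ (expR (- (series (geometric a r) m / (1 - a))))).
  rewrite ler_expR lerN2 ler_pM2r ?invr_gt0 ?subr_gt0 //.
  by apply: geometric_le_lim; rewrite // gtr0_norm.
elim: m => [|m IHm]; first by rewrite /qpoch big_nil /series /= big_nil mul0r oppr0 expR0.
rewrite /qpoch big_nat_recr //= -/(qpoch a r m) seriesEnat /= big_nat_recr //=.
rewrite mulrDl opprD expRD; apply: ler_pM; rewrite ?expR_ge0 //.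
set t := a * r ^+ m.
have t_ge0 : 0 <= t by rewrite mulr_ge0 ?exprn_ge0 ?(ltW r_gt0).
have t_le : t <= a by rewrite ler_piMr // exprn_ile1 ?(ltW r_gt0) ?(ltW r_lt1).
have t_lt1 : 0 < 1 - t by rewrite subr_gt0 (le_lt_trans t_le).
rewrite expRN -[leRHS]invrK lef_pV2 ?posrE ?invr_gt0 ?expR_gt0 //.
apply: le_trans (expR_ge1Dx _).
rewrite -[leLHS]mul1r ler_pdivrMr // mulrDl mul1r.
rewrite -[leLHS](subrK t) lerD2l -mulrA ler_peMr //.
by rewrite mulrC ler_pdivlMr ?subr_gt0 // mul1r lerD2l lerN2.
Qed.

Lemma qpoch_cvg (R : realType) (a r : R) : 0 <= a < 1 -> 0 < r < 1 ->
  qpoch a r m @[m --> \oo] --> qpoch_inf a r.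
Proof.
move=> a01 r01; apply: nonincreasing_is_cvgn; first exact: qpoch_nonincreasing.
exists 0 => _ [m _ <-]; apply: le_trans (qpoch_ge_expR m a01 r01).
exact: expR_ge0.
Qed.

Lemma qpoch_inf_gt0 (R : realType) (a r : R) : 0 <= a < 1 -> 0 < r < 1 -> 0 < qpoch_inf a r.
Proof.
move=> a01 r01; apply: lt_le_trans (expR_gt0 _) _.
apply: limr_ge; first exact: qpoch_cvg.
by apply: nearW => m; exact: qpoch_ge_expR.
Qed.

Lemma cvg_prod_exprz (R : realType) (I : Type) (s : seq I) (P : pred I) (z : I -> int)
    (u : I -> nat -> R) (l : I -> R) :
  (forall i, P i -> l i != 0) ->
  (forall i, P i -> u i k @[k --> \oo] --> l i) ->
  \prod_(i <- s | P i) u i k ^ z i @[k --> \oo] -->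
  \prod_(i <- s | P i) l i ^ z i.
Proof.
move=> l_neq0 u_l; apply: cvg_big => [|i Pi]; first exact: mul_continuous.
have powX m : u i k ^+ m @[k --> \oo] --> l i ^+ m.
  exact: (continuous_cvg _ (@exprn_continuous _ m (l i)) (u_l i Pi)).
case: (z i) => m; first exact: powX.
by apply: cvgV; [rewrite expf_neq0 ?l_neq0|exact: powX].
Qed.

(** Indexing the factors by the exponent of [x] makes the factorials for
    different [x = y ^+ (n %/ d)] restrictions of a single function of the
    exponent of [y]. *)
Lemma qpoch_shiftE (R : realType) (a x : R) (e M : nat) :
  qpoch (a * x ^+ e) x M =
  \prod_(0 <= m < M + e) (if (e <= m)%N then 1 - a * x ^+ m else 1).
Proof.
rewrite (big_cat_nat (n := e)) ?leq_addl //= big_nat_cond big1 ?mul1r; last first.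
  by move=> m /andP[/andP[_ m_e] _]; rewrite leqNgt m_e.
rewrite -{2}[e]add0n big_addn addnK; apply: eq_bigr => m _.
by rewrite leq_addl -mulrA -exprD addnC.
Qed.

(** * Moebius products of infinite shifted factorials *)

(** The threshold [t] covers both families of Moebius products: [t = 1] with
    [e d = 1] for the base points [q^(1/d)], and [t = n] with [e d = d] for the
    base point [q]. *)
Lemma cvg_prod_coprime (R : realType) (x : R) (n t : nat) (e : nat -> nat) :
  0 < x < 1 -> (0 < n)%N -> (0 < t)%N ->
  (forall d, (d %| n)%N -> (0 < e d <= d)%N) ->
  (forall d m, (d %| n)%N -> (e d <= m)%N = (t <= m * (n %/ d))%N) ->
  \prod_(0 <= k < N.+1 * n | coprime k n) (if (t <= k)%N then 1 - x ^+ k else 1)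
    @[N --> \oo] -->
  \prod_(d <- divisors n)
    qpoch_inf ((x ^+ (n %/ d)) ^+ e d) (x ^+ (n %/ d)) ^ moebius (n %/ d).
Proof.
move=> /andP[x_gt0 x_lt1] n_gt0 t_gt0 e_le eE.
pose F k := if (t <= k)%N then 1 - x ^+ k else 1.
have F_neq0 k : F k != 0.
  rewrite /F; case: leqP => [t_k|_]; last exact: oner_neq0.
  by rewrite subr_eq0 eq_sym lt_eqF // exprn_ilt1 ?(ltW x_gt0) // -lt0n (leq_trans t_gt0).
have powx01 j : (0 < j)%N -> 0 < x ^+ j < 1.
  by move=> j_gt0; rewrite exprn_gt0 //= exprn_ilt1 ?(ltW x_gt0) // -lt0n.
(* The factorial for [d] is cut at length [N.+1 * d - e d], so that its exponents
   of [x] fill the range below [N.+1 * n] for every [d]. *)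
rewrite (_ : (fun N => _) = fun N : nat => \prod_(d <- divisors n | d \in divisors n)
   qpoch ((x ^+ (n %/ d)) ^+ e d) (x ^+ (n %/ d)) (N.+1 * d - e d) ^
     moebius (n %/ d)); last first.
  apply: funext => N.
  rewrite -(prod_divisors_moebius _ n_gt0 F_neq0) big_seq; apply: eq_bigr => d.
  rewrite -dvdn_divisors // => d_n; congr (_ ^ _).
  rewrite -[in RHS](mul1r (_ ^+ e d)) qpoch_shiftE subnK; last first.
    by rewrite mulSn (leq_trans _ (leq_addr _ _)) //; case/andP: (e_le _ d_n).
  by apply: eq_bigr => m _; rewrite /F eE // mul1r -exprM mulnC.
rewrite [X in _ --> X]big_seq; apply: cvg_prod_exprz => d; rewrite -dvdn_divisors // => d_n.
all: have nd_gt0 : (0 < n %/ d)%N by apply: (dvdn_gt0 n_gt0); apply: dvdn_div.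
all: have y01 := powx01 _ nd_gt0.
all: have /andP[ed_gt0 ed_le] := e_le _ d_n.
all: have ye01 : 0 <= (x ^+ (n %/ d)) ^+ e d < 1 by
  rewrite -exprM exprn_ge0 ?(ltW x_gt0) //= (andP (powx01 _ _)).2 ?muln_gt0 ?nd_gt0.
  by rewrite gt_eqF // qpoch_inf_gt0.
apply: (cvg_comp (fun N : nat => N.+1 * d - e d)%N _ _ (qpoch_cvg ye01 y01)).
apply/cvgnyPge => A; near=> N; rewrite mulSnr -addnBA //.
apply: leq_trans (leq_addr _ _); apply: (@leq_trans N); first by near: N; exact: nbhs_infty_ge.
by rewrite leq_pmulr // (leq_trans ed_gt0).
Unshelve. all: by end_near.
Qed.

(** * The three inequalities *)

Theorem theorem12 (R : realType) (q : R) (n : nat) (q_gt0 : 0 < q)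
    (q_lt1 : q < 1) (n_gt1 : (1 < n)%N) :
  qpoch_inf (q `^ (2%:R^-1)) q ^+ totient n >=
  sup [set
    \prod_(d <- divisors n)
      qpoch_inf (q `^ (d%:R^-1)) (q `^ (d%:R^-1)) ^ moebius (n %/ d);
    (1 - q `^ (2%:R^-1)) ^+ totient n *
      \prod_(d <- divisors n) qpoch_inf q (q `^ (d%:R^-1)) ^ moebius (n %/ d);
    (1 + q `^ (2%:R^-1)) ^+ totient n *
      ((\prod_(d <- divisors n)
          qpoch_inf (q `^ (d%:R^-1)) (q `^ (d%:R^-1)) ^ moebius (n %/ d)) /
       (\prod_(d <- divisors n)
          qpoch (- q `^ (d%:R^-1)) (q `^ (d%:R^-1)) d.-1 ^ moebius (n %/ d)))].
Proof.
have n_gt0 : (0 < n)%N := ltnW n_gt1.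
set h := q `^ 2%:R^-1; pose x := q `^ n%:R^-1.
have root01 m : (0 < m)%N -> 0 < q `^ m%:R^-1 < 1 /\ (q `^ m%:R^-1) ^+ m = q.
  move=> m_gt0; have rE : (q `^ m%:R^-1) ^+ m = q.
    by rewrite -powR_mulrn ?powR_ge0 // -powRrM mulVf ?pnatr_eq0 -?lt0n // powRr1 ?ltW.
  by rewrite powR_gt0 //= -(expr_lt1 m_gt0) ?powR_ge0 // rE.
have [x01 xE] : 0 < x < 1 /\ x ^+ n = q := root01 n n_gt0.
have [h01 hE] : 0 < h < 1 /\ h ^+ 2 = q := root01 2%N isT.
have [[x_gt0 x_lt1] [h_gt0 h_lt1]] := (andP x01, andP h01).
have xle : 0 <= x <= 1 by rewrite !ltW.
have hle : 0 <= h <= 1 by rewrite !ltW.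
have hxE : h ^+ 2 = x ^+ n by rewrite hE xE.
have rootE d : (d %| n)%N -> q `^ d%:R^-1 = x ^+ (n %/ d).
  move=> d_n; rewrite -powR_mulrn ?powR_ge0 // /x -powRrM; congr (_ `^ _).
  have d_gt0 : (0 < d)%N := dvdn_gt0 n_gt0 d_n.
  rewrite -{1}(divnK d_n) natrM invfM mulrC mulrA mulfV ?mul1r //.
  by rewrite pnatr_eq0 -lt0n; apply: (dvdn_gt0 n_gt0); apply: dvdn_div.
(* [E j] collects the [totient n] copies of the [j]-th factor of the left-hand
   side; [blk j] is the [j]-th block of the product over coprime integers. *)
pose E j := (1 - h * q ^+ j) ^+ totient n.
pose blk j := \prod_(0 <= i < n | coprime i n) (1 - x ^+ (j * n + i)).
have blk_ge0 j : 0 <= blk j.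
  by apply: prodr_ge0 => i _; rewrite subr_ge0 exprn_ile1 ?ltW.
have blk_le j : blk j <= E j by rewrite /E -xE; exact: block_le.
have cvgE : \prod_(0 <= j < N.+1) E j @[N --> \oo] --> qpoch_inf h q ^+ totient n.
  have qh : qpoch h q N.+1 @[N --> \oo] --> qpoch_inf h q.
    have := qpoch_cvg (r := q) (a := h); rewrite -cvg_shiftS /=; apply.
      by rewrite h_lt1 ltW.
    by rewrite q_gt0.
  under eq_fun => N do rewrite /E prodrXl.
  exact: (continuous_cvg _ (@exprn_continuous _ _ _) qh).
have thr1 d m : (d %| n)%N -> (1 <= m)%N = (1 <= m * (n %/ d))%N.
  move=> d_n; rewrite muln_gt0 andbC (_ : 0 < n %/ d)%N //.
  by apply: (dvdn_gt0 n_gt0); apply: dvdn_div.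
have thrn d m : (d %| n)%N -> (d <= m)%N = (n <= m * (n %/ d))%N.
  move=> d_n; rewrite -{1}(divnK d_n) [(_ * d)%N]mulnC leq_pmul2r //.
  by apply: (dvdn_gt0 n_gt0); apply: dvdn_div.
(* In [cvg_prod_coprime] the factor for [k = 0] is 1, whereas [1 - x ^+ 0 = 0];
   as [1 < n], this [k] is not coprime to [n] and the discrepancy is harmless. *)
have cop_gt0 k : coprime k n -> (0 < k)%N.
  by case: k => //; rewrite /coprime gcd0n gtn_eqF.
have cvg1 : \prod_(0 <= j < N.+1) blk j @[N --> \oo] -->
    \prod_(d <- divisors n)
      qpoch_inf (q `^ (d%:R^-1)) (q `^ (d%:R^-1)) ^ moebius (n %/ d).
  rewrite (_ : \prod_(d <- _) _ = \prod_(d <- divisors n)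
      qpoch_inf ((x ^+ (n %/ d)) ^+ 1) (x ^+ (n %/ d)) ^ moebius (n %/ d)); last first.
    rewrite big_seq [RHS]big_seq; apply: eq_bigr => d.
    by rewrite -dvdn_divisors // => /rootE ->; rewrite expr1.
  have := @cvg_prod_coprime _ x n 1 (fun=> 1%N) x01 n_gt0 isT _ thr1.
  under eq_fun => N.
    rewrite prod_coprime_blocks.
    under eq_bigr => j _.
      under eq_bigr => i /cop_gt0 i_gt0 do rewrite addn_gt0 i_gt0 orbT.
      over.
    over.
  by apply => d /(dvdn_gt0 n_gt0).
have cvg2 : \prod_(1 <= j < N.+1) blk j @[N --> \oo] -->
    \prod_(d <- divisors n) qpoch_inf q (q `^ (d%:R^-1)) ^ moebius (n %/ d).
  rewrite (_ : \prod_(d <- _) _ = \prod_(d <- divisors n)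
      qpoch_inf ((x ^+ (n %/ d)) ^+ d) (x ^+ (n %/ d)) ^ moebius (n %/ d)); last first.
    rewrite big_seq [RHS]big_seq; apply: eq_bigr => d.
    by rewrite -dvdn_divisors // => d_n; rewrite rootE // -exprM divnK // xE.
  have := @cvg_prod_coprime _ x n n id x01 n_gt0 n_gt0 _ thrn.
  rewrite [X in X @ _](_ : _ = fun N : nat => \prod_(1 <= j < N.+1) blk j).
    by apply => d /(dvdn_gt0 n_gt0) -> /=.
  apply: funext => N; rewrite prod_coprime_blocks big_nat_recl // big_add1 /=.
  rewrite [X in X * _]big_nat_cond [X in X * _]big1 ?mul1r; last first.
    by move=> i /andP[/andP[_ i_n] _]; rewrite mul0n add0n leqNgt i_n.
  apply: eq_bigr => j _; apply: eq_bigr => i _.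
  by rewrite mulSn -addnA leq_addr.
have denE : \prod_(d <- divisors n)
      qpoch (- q `^ (d%:R^-1)) (q `^ (d%:R^-1)) d.-1 ^ moebius (n %/ d) =
    \prod_(0 <= k < n | coprime k n) (1 + x ^+ k).
  pose F k := if (1 <= k)%N then 1 - (- 1) * x ^+ k else 1.
  have F_neq0 k : F k != 0.
    rewrite /F; case: ifP => _; last exact: oner_neq0.
    by rewrite mulN1r opprK gt_eqF // ltr_wpDr // exprn_ge0 ?ltW.
  transitivity (\prod_(0 <= k < 1 * n | coprime k n) F k); last first.
    by rewrite mul1n; apply: eq_bigr => k /cop_gt0 k_gt0; rewrite /F k_gt0 mulN1r opprK.
  rewrite -(prod_divisors_moebius _ n_gt0 F_neq0) big_seq [RHS]big_seq.
  apply: eq_bigr => d; rewrite -dvdn_divisors // => d_n.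
  rewrite mul1n rootE // -mulN1r -[X in qpoch (_ * X)]expr1 qpoch_shiftE addn1.
  rewrite prednK ?(dvdn_gt0 n_gt0) //; congr (_ ^ _); apply: eq_bigr => m _.
  by rewrite /F (thr1 _ _ d_n) -exprM mulnC.
(* The factor [(1 + h) ^+ totient n] cancels the denominator of the bound
   [((1 - h) / (1 + h)) ^+ totient n] on the first block. *)
have blk0_le :
    (1 + h) ^+ totient n * (blk 0 / \prod_(0 <= k < n | coprime k n) (1 + x ^+ k))
    <= E 0.
  rewrite /blk -prodf_div; have /= := first_block_cayley_le xle hle hxE n_gt1.
  rewrite -(@ler_pM2l _ ((1 + h) ^+ totient n)) ?exprn_gt0 ?ltr_wpDr ?(ltW h_gt0) //.
  rewrite -exprMn [(1 + h) * _]mulrC divfK; last by rewrite gt_eqF // ltr_wpDr // ltW.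
  by rewrite /E expr0 mulr1 mul0n.
have tail_le N : \prod_(1 <= j < N.+1) blk j <= \prod_(1 <= j < N.+1) E j.
  by apply: ler_prod => j _; rewrite blk_ge0 blk_le.
have E_ge0 j : 0 <= E j by exact: le_trans (blk_ge0 j) (blk_le j).
have tailE_ge0 N : 0 <= \prod_(1 <= j < N.+1) E j by apply: prodr_ge0.
have tail_ge0 N : 0 <= \prod_(1 <= j < N.+1) blk j by apply: prodr_ge0.
rewrite denE; apply: ge_sup; first by eexists; left; left.
move=> y [[->|->]|->].
- apply: (ler_cvg_to cvg1 cvgE); apply: nearW => N.
  by apply: ler_prod => j _; rewrite blk_ge0 blk_le.
- apply: (ler_cvg_to (cvgM (cvg_cst _) cvg2) cvgE); apply: nearW => N /=.
  rewrite [leRHS]big_ltn //; apply: ler_pM => //.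
    by rewrite exprn_ge0 // subr_ge0 ltW.
  by rewrite /E expr0 mulr1.
apply: (ler_cvg_to (cvgM (cvg_cst _) (cvgM cvg1 (cvg_cst _))) cvgE); apply: nearW => N /=.
rewrite [leRHS]big_ltn // [in leLHS]big_ltn // mulrAC mulrA ler_pM //.
rewrite mulr_ge0 ?divr_ge0 ?exprn_ge0 ?addr_ge0 ?(ltW h_gt0) //.
by apply: prodr_ge0 => k _; rewrite addr_ge0 ?exprn_ge0 ?ltW.
Qed.
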